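(* Let $F\subset\mathbb{R}^d$ be a compact convex set with $0\in\operatorname{int}(F)$, and let $m\ge2$, $1\le k\le m$. Let $\hat\Omega\in\mathcal{K}^m$ and let $\hat x\in S_k^{\mathrm{loc}}(\hat\Omega)$ be a strict local optimal solution of the problem of minimizing $f_k(\cdot,\hat\Omega)$ over $\mathbb{R}^{dk}$. Then the local solution mapping $S_k^{\mathrm{loc}}:(\mathcal{K}^m,d_{\mathcal{K}^m})\rightrightarrows\mathbb{R}^{dk}$ is inner semicontinuous at $(\hat\Omega,\hat x)$.
   Context: $\mathbb{R}^d$ ($d\ge1$) and $\mathbb{R}^{dk}=(\mathbb{R}^d)^k$ carry their Euclidean norms; $\mathbb{B}(a;r)$ is the open ball. The minimal time function is $T_F(x,\Omega)=\inf\{t\ge 0\mid (x+tF)\cap\Omega\neq\emptyset\}$ for $x\in\mathbb{R}^d$ and nonempty $\Omega\subset\mathbb{R}^d$. $\mathcal{K}$ is the family of nonempty compact subsets of $\mathbb{R}^d$ with the Hausdorff metric $d_{\mathcal{K}}(A,B)=\max\{\sup_{a\in A}\inf_{b\in B}\|a-b\|,\ \sup_{b\in B}\inf_{a\in A}\|a-b\|\}$; on $\mathcal{K}^m$, $d_{\mathcal{K}^m}(\Omega,\hat\Omega)=\max_{1\le i\le m}d_{\mathcal{K}}(\Omega^i,\hat\Omega^i)$ for $\Omega=(\Omega^1,\dots,\Omega^m)$, $\hat\Omega=(\hat\Omega^1,\dots,\hat\Omega^m)$. For $x=(x^1,\dots,x^k)\in\mathbb{R}^{dk}$, $f_k(x,\Omega)=\sum_{i=1}^m\min_{1\le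 j\le k}T_F(x^j,\Omega^i)$. $S_k^{\mathrm{loc}}(\Omega)=\{x\in\mathbb{R}^{dk}\mid\exists\,\varepsilon>0:\ f_k(x,\Omega)\le f_k(y,\Omega)\ \text{for all }y\in\mathbb{B}(x;\varepsilon)\}$. A point $\hat x$ is a strict local optimal solution at $\hat\Omega$ if there is $\varepsilon>0$ with $f_k(\hat x,\hat\Omega)<f_k(y,\hat\Omega)$ for all $y\in\mathbb{B}(\hat x;\varepsilon)\setminus\{\hat x\}$. A set-valued mapping $G:\mathcal{K}^m\rightrightarrows\mathbb{R}^{dk}$ is inner semicontinuous at $(\hat\Omega,\hat x)$, where $\hat x\in G(\hat\Omega)$, if for every open $V\subset\mathbb{R}^{dk}$ with $\hat x\in V$ there is a neighborhood $U$ of $\hat\Omega$ such that $G(\Omega)\cap V\ne\emptyset$ for all $\Omega\in U$. *)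

(* Defs.v *)
From HB Require Import structures.
From mathcomp Require Import all_boot all_order all_algebra.
From mathcomp Require Import all_classical all_reals all_analysis.

Set Implicit Arguments.
Unset Strict Implicit.
Unset Printing Implicit Defensive.

Import Order.TTheory GRing.Theory Num.Theory.
Import numFieldNormedType.Exports.

Local Open Scope classical_set_scope.
Local Open Scope ring_scope.

(* A vector of R^d is a row vector; a point x = (x^1, ..., x^k) of
   R^(dk) = (R^d)^k is a k x d matrix whose j-th row is x^j. The canonical norm
   of 'M[R]_(k, d) is the sup norm, hence the explicit Euclidean norm below; the
   canonical topology (open, interior, compact) is the Euclidean one. *)

Definition enorm (R : realType) (p q : nat) (x : 'M[R]_(p, q)) : R :=
  Num.sqrt (\sum_(i < p) \sum_(j < q) x i j ^+ 2).

Definition eball (R : realType) (p q : nat) (a : 'M[R]_(p, q)) (r : R) :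
    set 'M[R]_(p, q) :=
  [set y | enorm (y - a) < r].

(* Infima and suprema are taken in \bar R, so that no value has to be invented
   for empty or unbounded sets. In particular inf set0 = +oo. *)

Definition mintime (R : realType) (d : nat) (F : set 'rV[R]_d)
    (x : 'rV[R]_d) (A : set 'rV[R]_d) : \bar R :=
  ereal_inf [set t%:E | t in
    [set t : R | 0 <= t /\ [set x + t *: f | f in F] `&` A !=set0]].

Definition cpt (R : realType) (d : nat) : Type :=
  {A : set 'rV[R]_d | compact A /\ A !=set0}.

Definition hausdorff_excess (R : realType) (d : nat) (A B : set 'rV[R]_d) :
    \bar R :=
  ereal_sup [set ereal_inf [set (enorm (a - b))%:E | b in B] | a in A].

Definition dist_cpt (R : realType) (d : nat) (A B : cpt R d) : \bar R :=
  maxe (hausdorff_excess (sval A) (sval B))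
       (hausdorff_excess (sval B) (sval A)).

Definition dist_cpts (R : realType) (d m : nat) (Om Om' : 'I_m -> cpt R d) :
    \bar R :=
  \big[maxe/-oo%E]_(i < m) dist_cpt (Om i) (Om' i).

Definition nbhs_cpts (R : realType) (d m : nat) (Om : 'I_m -> cpt R d) :
    set_system ('I_m -> cpt R d) :=
  nbhs_ball_ (fun A (r : R) => [set B | (dist_cpts A B < r%:E)%E]) Om.

Definition fk (R : realType) (d m k : nat) (F : set 'rV[R]_d)
    (x : 'M[R]_(k, d)) (Om : 'I_m -> cpt R d) : \bar R :=
  (\sum_(i < m) \big[mine/+oo]_(j < k) mintime F (row j x) (sval (Om i)))%E.

Definition Sloc (R : realType) (d m k : nat) (F : set 'rV[R]_d)
    (Om : 'I_m -> cpt R d) : set 'M[R]_(k, d) :=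
  [set x | exists eps : R, 0 < eps /\
    forall y, eball x eps y -> (fk F x Om <= fk F y Om)%E].

Definition strict_local_sol (R : realType) (d m k : nat) (F : set 'rV[R]_d)
    (Om : 'I_m -> cpt R d) (x : 'M[R]_(k, d)) : Prop :=
  exists eps : R, 0 < eps /\
    forall y, (eball x eps `\ x) y -> (fk F x Om < fk F y Om)%E.

Definition inner_semicontinuous (R : realType) (d m : nat)
    (T : topologicalType) (G : ('I_m -> cpt R d) -> set T)
    (Om : 'I_m -> cpt R d) (x : T) : Prop :=
  forall V : set T, open V -> V x ->
    exists U, nbhs_cpts Om U /\ forall Om', U Om' -> G Om' `&` V !=set0.

(* Main.v *)
Require Import Defs.
From HB Require Import structures.
From mathcomp Require Import all_boot all_order all_algebra.
From mathcomp Require Import all_classical all_reals all_analysis.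
From mathcomp Require Import ring lra.

Set Implicit Arguments.
Unset Strict Implicit.
Unset Printing Implicit Defensive.

Import Order.TTheory GRing.Theory Num.Theory.
Import numFieldNormedType.Exports.

Local Open Scope classical_set_scope.
Local Open Scope ring_scope.

(** Strictness and compactness of a small sphere around [x] give a gap [a > 0]
  between [fk F x Om] and the values of [fk F _ Om] on that sphere. If [F]
  contains the ball of radius [r], then [fk F y Om] is Lipschitz in [(y, Om)]
  with a constant depending only on [m] and [r], so for [Om'] near [Om] the
  values of [fk F _ Om'] on the sphere still exceed [fk F x Om']. A minimizer of
  [fk F _ Om'] over the closed ball is therefore interior, hence a local
  solution close to [x]. All balls and spheres are those of the sup norm, the
  library's norm on matrices. *)

Lemma lipschitz_continuous (R : realType) (V W : normedModType R) (f : V -> W)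
    (c : R) :
  (forall x y, `|f x - f y| <= c * `|x - y|) -> continuous f.
Proof.
move=> fc x; apply/cvgrPdist_lt => e e0; near=> y.
apply: (le_lt_trans (fc x y)).
(* The constant [c] may be zero or negative; [|c| + 1] is a Lipschitz constant by which one can
   divide. *)
have c0 : 0 < `|c| + 1 by rewrite ltr_wpDl.
apply: (@le_lt_trans _ _ ((`|c| + 1) * `|x - y|)).
  by rewrite ler_wpM2r// (le_trans (ler_norm _))// lerDl.
rewrite mulrC -ltr_pdivlMr//; near: y; apply: cvgr_dist_lt => //.
exact: divr_gt0.
Unshelve. all: end_near. Qed.

Lemma normr_entry_le (R : realType) p q (M : 'M[R]_(p, q)) i j :
  `|M i j| <= `|M|.
Proof.
rewrite [leRHS]/Num.norm/= mx_normrE.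
exact: (@le_bigmax _ _ _ 0 (fun ij => `|M ij.1 ij.2|) (i, j)).
Qed.

Lemma mx_normr_le (R : realType) p q (M : 'M[R]_(p, q)) c :
  0 <= c -> (forall i j, `|M i j| <= c) -> `|M| <= c.
Proof.
move=> c0 Mc; rewrite [leLHS]/Num.norm/= mx_normrE.
by apply/bigmax_leP; split=> // -[i j] _; exact: Mc.
Qed.

Section norms.
Variables (R : realType) (p q : nat).
Implicit Type M : 'M[R]_(p, q).

Lemma normr_le_enorm M : `|M| <= enorm M.
Proof.
apply: mx_normr_le => [|i j]; first exact: sqrtr_ge0.
rewrite -sqrtr_sqr ler_sqrt; last first.
  by apply: sumr_ge0 => ? _; apply: sumr_ge0 => ? _; exact: sqr_ge0.
rewrite (bigD1 i)//= (bigD1 j)//= -addrA lerDl addr_ge0//.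
  by apply: sumr_ge0 => ? _; exact: sqr_ge0.
by apply: sumr_ge0 => ? _; apply: sumr_ge0 => ? _; exact: sqr_ge0.
Qed.

(** The squares sum to at most [p * q] times the squared sup norm; bounding [p * q] by its square
    avoids a root in the constant. *)
Lemma enorm_le_normr M : enorm M <= (p * q)%:R * `|M|.
Proof.
have MM : 0 <= (p * q)%:R * `|M| by rewrite mulr_ge0.
rewrite -[leRHS]ger0_norm// -sqrtr_sqr ler_sqrt ?sqr_ge0//.
apply: (@le_trans _ _ (\sum_(i < p) \sum_(j < q) `|M| ^+ 2)).
  apply: ler_sum => i _; apply: ler_sum => j _.
  by rewrite -[leLHS]real_normK ?num_real// lerXn2r ?nnegrE// normr_entry_le.
rewrite !sumr_const !card_ord -mulrnA mulnC -[leLHS]mulr_natl exprMn.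
rewrite ler_wpM2r ?sqr_ge0//.
by rewrite -natrX ler_nat; case: (p * q)%N => // n; rewrite leq_pmulr.
Qed.

(** The ball is the image of a closed ball of row vectors, compact by Heine-Borel, under reshaping
    and translation, a 1-Lipschitz map for the sup norm. *)
Lemma closed_mx_ball_compact (a : 'M[R]_(p, q)) (r : R) :
  compact [set M | `|M - a| <= r].
Proof.
have <- : (fun v => vec_mx v + a) @` [set v : 'rV[R]_(p * q) | `|v| <= r] =
    [set M | `|M - a| <= r].
  apply/seteqP; split=> [_ [v /= vr <-]|M /= Mr].
    rewrite addrK; apply: mx_normr_le => [|i j]; first exact: le_trans vr.
    by rewrite mxE; exact: le_trans (normr_entry_le _ _ _) vr.
  exists (mxvec (M - a)); last by rewrite mxvecK subrK.
  apply: mx_normr_le => [|i j]; first exact: le_trans Mr.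
  rewrite ord1; case/mxvec_indexP: j => i' j'; rewrite mxvecE.
  exact: le_trans (normr_entry_le _ _ _) Mr.
apply: continuous_compact.
  apply: continuous_subspaceT => v.
  move: v; apply: (@lipschitz_continuous _ _ _ _ 1) => v w /=.
  rewrite opprD addrACA subrr addr0 -linearB mul1r.
  apply: mx_normr_le => // i j; rewrite mxE; exact: normr_entry_le.
apply: bounded_closed_compact.
  exists r; split=> [|y ry v /= vr]; first exact: num_real.
  exact: le_trans vr (ltW ry).
apply: (@closed_comp _ _ (fun v : 'rV[R]_(p * q) => `|v|) [set y | y <= r]).
  by move=> v _; exact: norm_continuous.
exact: closed_le.
Qed.

End norms.
Arguments closed_mx_ball_compact {R p q} a r.

(** The convex combination with weights s/(s+t) and t/(s+t) serves as [h]. The value s = 0 is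
    allowed because [s] will be an arrival time. *)
Lemma convex_set_conic (R : realType) (V : lmodType R) (F : set V) (s t : R)
    (f g : V) : convex_set F -> 0 <= s -> 0 < t -> F f -> F g ->
  exists2 h, F h & (s + t) *: h = s *: f + t *: g.
Proof.
move=> convF s0 t0 Ff Fg; have st0 : 0 < s + t by rewrite ltr_wpDl.
have p0 : 0 <= s / (s + t) by rewrite divr_ge0// ltW.
have p1 : s / (s + t) <= 1 by rewrite ler_pdivrMr// mul1r lerDl ltW.
exists (s / (s + t) *: f + (1 - s / (s + t)) *: g).
  by have := convF f g (Itv01 p0 p1); rewrite !inE; exact.
rewrite scalerDr !scalerA mulrBr mulr1 mulrCA divff ?gt_eqF// mulr1.
by rewrite addrAC subrr add0r.
Qed.

Section minimal_time.
Variables (R : realType) (d : nat) (F : set 'rV[R]_d) (r : R).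
Hypotheses (convF : convex_set F) (r0 : 0 < r)
  (rF : forall v : 'rV[R]_d, `|v| < r -> F v).

Lemma mintime_ge0 (x : 'rV[R]_d) A : (0 <= mintime F x A)%E.
Proof. by apply/ereal_infP => _ [t [t0 _] <-]; rewrite lee_fin. Qed.

Lemma mintime_fin_num (x : 'rV[R]_d) A :
  A !=set0 -> mintime F x A \is a fin_num.
Proof.
move=> [a Aa]; rewrite ge0_fin_numE ?mintime_ge0//.
(* At this time [a] is reached: the added 1 keeps the time positive when [a = x] and makes the
   velocity shorter than [r]. *)
have t0 : 0 < (`|a - x| + 1) / r by rewrite divr_gt0// ltr_wpDl.
apply: (@le_lt_trans _ _ ((`|a - x| + 1) / r)%:E); last exact: ltry.
apply: ge_ereal_inf; exists ((`|a - x| + 1) / r)%:E => //.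
exists ((`|a - x| + 1) / r) => //; split; first exact: ltW.
exists a; split => //; exists (((`|a - x| + 1) / r)^-1 *: (a - x)).
  apply: rF; rewrite normrZ gtr0_norm ?invr_gt0// invf_div mulrAC.
  by rewrite ltr_pdivrMr ?ltr_wpDl// ltr_pM2l// ltrDl.
by rewrite scalerA divff ?gt_eqF// scale1r addrC subrK.
Qed.

(* Convexity of F gives tF + cF = (t + c)F, and cF contains the ball of radius
   c r: a point reached at time t can thus be moved by less than c r at the cost
   of an additional time c. *)
Lemma mintime_le (x y : 'rV[R]_d) A B (c : R) : 0 < c ->
  (forall b, B b -> exists2 a, A a & `|(a - b) + (y - x)| < c * r) ->
  (mintime F x A <= mintime F y B + c%:E)%E.
Proof.
move=> c0 BA; rewrite -leeBlDr//; apply/ereal_infP => _ [t [t0 tB] <-].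
rewrite leeBlDr// -EFinD.
case: tB => _ [[f Ff <-] /BA [a Aa abr]].
have Fg : F (c^-1 *: ((a - (y + t *: f)) + (y - x))).
  by apply: rF; rewrite normrZ gtr0_norm ?invr_gt0// mulrC ltr_pdivrMr// mulrC.
have [h Fh hE] := convex_set_conic convF t0 c0 Ff Fg.
apply: ge_ereal_inf; exists (t + c)%:E => //; exists (t + c) => //.
split; first by rewrite addr_ge0// ltW.
exists a; split => //; exists h => //.
rewrite hE scalerA divff ?gt_eqF// scale1r opprD.
by apply/rowP => j; rewrite !mxE; ring.
Qed.

Variables (m k : nat).
Hypothesis k0 : (0 < k)%N.
Implicit Types (Om : 'I_m -> cpt R d) (y : 'M[R]_(k, d)).

Lemma fk_fin_num Om y : fk F y Om \is a fin_num.
Proof.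
apply/sum_fin_numP => i _ _; have [_ Omi] := svalP (Om i).
rewrite ge0_fin_numE; last first.
  by apply/bigmin_geP; split; [exact: leey | move=> j _; exact: mintime_ge0].
(* Some index exists since [k] is positive; a minimum over no index would be +oo. *)
apply: le_lt_trans (bigmin_le _ (Ordinal k0) _) _.
by rewrite -ge0_fin_numE ?mintime_fin_num ?mintime_ge0.
Qed.

(** Minima are compared index by index, and by [mintime_le] each of the [m] terms grows by at most
    [c]. *)
Lemma fk_le Om Om' y y' (c e : R) : 0 < c ->
  (forall i b, sval (Om i) b -> exists2 a, sval (Om' i) a & `|a - b| <= e) ->
  e + `|y - y'| < c * r -> (fk F y' Om' <= fk F y Om + (m%:R * c)%:E)%E.
Proof.
move=> c0 OmOm' eyc.
have -> : (m%:R * c)%:E = (\sum_(i < m) c%:E)%E.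
  by rewrite sumEFin sumr_const card_ord mulr_natl.
rewrite /fk -big_split/=; apply: lee_sum => i _.
rewrite -leeBlDr//; apply/bigmin_geP; split=> [|j _]; first exact: leey.
rewrite leeBlDr//; apply: le_trans (bigmin_le _ j _) _.
apply: mintime_le => // b /OmOm' [a Aa abe]; exists a => //.
apply: le_lt_trans eyc; apply: (le_trans (ler_normD _ _)); rewrite lerD//.
apply: mx_normr_le => // i' l; rewrite -linearB mxE; exact: normr_entry_le.
Qed.

Lemma fk_continuous Om : continuous (fun y => fine (fk F y Om)).
Proof.
apply: (@lipschitz_continuous _ _ _ _ (m%:R * (2 / r))).
have lip y y' :
    fine (fk F y' Om) <= fine (fk F y Om) + m%:R * (2 / r) * `|y - y'|.
  (* For distinct points [fk_le] is applied with the time (2/r)|y - y'|, which is then positive; the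
     factor 2 makes its last hypothesis strict. *)
  have [->|yy'] := eqVneq y y'; first by rewrite subrr normr0 mulr0 addr0.
  have n0 : 0 < `|y - y'| by rewrite normr_gt0 subr_eq0.
  rewrite -lee_fin EFinD !fineK ?fk_fin_num// -mulrA.
  apply: (fk_le (e := 0)); first by rewrite mulr_gt0// divr_gt0.
    by move=> i b Ab; exists b => //; rewrite subrr normr0.
  by rewrite add0r mulrAC mulfVK ?gt_eqF// mulrC ltr_pMr// ltr1n.
move=> y y' /=; rewrite ler_distlC; apply/andP; split.
  by rewrite lerBlDr distrC; exact: lip.
exact: lip.
Qed.

End minimal_time.

(** An infimum below [e] is witnessed by a point at Euclidean distance below [e], and the sup norm
    is no larger. *)
Lemma dist_cpt_lt_approx (R : realType) (d : nat) (A B : cpt R d) (e : R) :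
  (dist_cpt A B < e%:E)%E ->
  (forall a, sval A a -> exists2 b, sval B b & `|b - a| <= e) /\
  (forall b, sval B b -> exists2 a, sval A a & `|a - b| <= e).
Proof.
have excess (C D : set 'rV[R]_d) : (hausdorff_excess C D < e%:E)%E ->
    forall a, C a -> exists2 b, D b & `|b - a| <= e.
  move=> CD a Ca; have : (ereal_inf [set (enorm (a - b))%:E | b in D] < e%:E)%E.
    by apply: le_lt_trans CD; apply: ereal_sup_ubound; exists a.
  move=> /ereal_inf_lt [_ [b Db <-]]; rewrite lte_fin => abe; exists b => //.
  by rewrite distrC; apply: le_trans (normr_le_enorm _) _; exact: ltW.
by rewrite gt_max => /andP[AB BA]; split; exact: excess.
Qed.

Theorem proposition6p7 (R : realType) (d m k : nat) (hd : (1 <= d)%N)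
    (hm : (2 <= m)%N) (hk1 : (1 <= k)%N) (hkm : (k <= m)%N)
    (F : set 'rV[R]_d) (Fcompact : compact F) (Fconvex : convex_set F)
    (F0 : interior F 0)
    (Om : 'I_m -> cpt R d) (x : 'M[R]_(k, d))
    (xloc : @Sloc R d m k F Om x)
    (xstrict : strict_local_sol F Om x) :
  inner_semicontinuous (@Sloc R d m k F) Om x.
Proof.
move=> V oV Vx.
have [r /= r0 rF'] : exists2 r : R, 0 < r & ball (0 : 'rV[R]_d) r `<=` F.
  by apply/nbhs_ballP; exact: F0.
have rF (v : 'rV[R]_d) : `|v| < r -> F v.
  by move=> vr; apply: rF'; rewrite -ball_normE /= sub0r normrN.
have [s /= s0 sV] : exists2 s : R, 0 < s & ball x s `<=` V.
  by apply/nbhs_ballP; exact: open_nbhs_nbhs.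
have [eps [eps0 epsx]] := xstrict.
(* [N] strictly dominates the factor between the two norms, so that the sup sphere of radius [delta]
   lies in the Euclidean ball of radius [eps]. *)
pose N : R := (k * d)%:R + 1.
have N0 : 0 < N by rewrite ltr_wpDl.
pose delta := Num.min (s / 2) (eps / N).
have delta0 : 0 < delta by rewrite lt_min !divr_gt0.
have deltaV y : `|y - x| < delta -> V y.
  rewrite lt_min => /andP[ys _]; apply: sV; rewrite -ball_normE /= distrC.
  by apply: lt_trans ys _; rewrite ltr_pdivrMr// ltr_pMr// ltr1n.
pose g (Om : 'I_m -> cpt R d) (y : 'M[R]_(k, d)) := fine (fk F y Om).
have fkE Om' y : fk F y Om' = (g Om' y)%:E.
  by rewrite fineK// (fk_fin_num r0 rF hk1).
have deltax y : `|y - x| = delta -> g Om x < g Om y.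
  move=> yx; have [yx0|yx0] := eqVneq y x.
    by move: yx delta0; rewrite yx0 subrr normr0 => <-; rewrite !ltxx.
  rewrite -lte_fin -!fkE; apply: epsx; split; last first.
    by move=> /= /eqP; exact/negP.
  apply: le_lt_trans (enorm_le_normr _) _; rewrite yx.
  apply: (@lt_le_trans _ _ (N * delta)); first by rewrite ltr_pM2r// ltrDl.
  by rewrite mulrC -ler_pdivlMr// ge_min lexx orbT.
have gc Om' : continuous (g Om') by exact: (fk_continuous Fconvex r0 rF hk1).
have [a a0 ga] : exists2 a, 0 < a &
    forall y, `|y - x| = delta -> g Om x + a <= g Om y.
  (* A minimum is attained on a nonempty sphere only; on an empty one any gap works. *)
  have [K0|/set0P K0] := eqVneq [set y : 'M[R]_(k, d) | `|y - x| = delta] set0.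
    exists 1 => // y yd; suff : (set0 : set 'M[R]_(k, d)) y by [].
    by rewrite -K0.
  have Kc : compact [set y : 'M[R]_(k, d) | `|y - x| = delta].
    apply: subclosed_compact (closed_mx_ball_compact x delta) _; last first.
      by move=> y /= ->.
    apply: (@closed_comp _ _ (fun y : 'M[R]_(k, d) => `|y - x|) [set delta]).
      move=> y _; apply: (@lipschitz_continuous _ _ _ _ 1) y => y y' /=.
      by rewrite mul1r (le_trans (ler_dist_dist _ _))// opprB addrA subrK.
    exact: closed_eq.
  have [z /[!inE]/= zd gz] := compact_EVT_min K0 Kc
    (continuous_subspaceT (gc Om)).
  exists (g Om z - g Om x); first by rewrite subr_gt0 deltax.
  by move=> y yd; rewrite addrC subrK gz// inE.
(* Passing between [Om] and [Om'] then changes the objective by at most m c = a/4; halving c r in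
   [e] leaves room for the strict inequality in [fk_le]. *)
pose c := a / (4 * m%:R).
have m0 : 0 < m%:R :> R by rewrite ltr0n ltnW.
have c0 : 0 < c by rewrite divr_gt0// mulr_gt0.
have cE : m%:R * c = a / 4 by rewrite /c; field; rewrite gt_eqF.
pose e := c * r / 2.
have ecr : e < c * r by rewrite ltr_pdivrMr// ltr_pMr ?ltr1n// mulr_gt0.
exists [set Om' | (dist_cpts Om Om' < e%:E)%E]; split.
  by exists e => //=; rewrite !(mulr_gt0, invr_gt0).
move=> Om' /bigmax_ltP[_ OmOm'].
have gle y : g Om y <= g Om' y + a / 4.
  rewrite -lee_fin EFinD -!fkE -cE; apply: (fk_le Fconvex rF c0 (e := e)).
    by move=> i; have [] := dist_cpt_lt_approx (OmOm' i isT).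
  by rewrite subrr normr0 addr0.
have gge y : g Om' y <= g Om y + a / 4.
  rewrite -lee_fin EFinD -!fkE -cE; apply: (fk_le Fconvex rF c0 (e := e)).
    by move=> i; have [] := dist_cpt_lt_approx (OmOm' i isT).
  by rewrite subrr normr0 addr0.
have B0 : [set y : 'M[R]_(k, d) | `|y - x| <= delta] !=set0.
  by exists x; rewrite /= subrr normr0 ltW.
have [z /[!inE]/= zd gz] := compact_EVT_min B0 (closed_mx_ball_compact x delta)
  (continuous_subspaceT (gc Om')).
have zx : g Om' z <= g Om' x by apply: gz; rewrite inE /= subrr normr0 ltW.
have zlt : `|z - x| < delta.
  (* On the sphere, the gap [a] would be at most two changes of a/4, one at [z] and one at [x]. *)
  rewrite lt_neqAle zd andbT; apply/eqP => /ga zxa.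
  by have := gle z; have := gge x; lra.
exists z; split; last exact: deltaV.
(* The Euclidean ball of this radius around [z] stays in the closed sup ball where [z] is a
   minimizer. *)
exists (delta - `|z - x|); split; first by rewrite subr_gt0.
move=> y yz; rewrite !fkE lee_fin; apply: gz; rewrite inE /=.
have := le_lt_trans (normr_le_enorm _) yz.
by have := ler_distD z y x; lra.
Qed.
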